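(* Let $M$ be a compact ${\bf R}^n$-aspherical manifold. Then the action of $\pi_1(M)$ on ${\bf R}^n$ is irreducible.
   Context: A group $G$ of homeomorphisms of ${\bf R}^n$ acts freely and properly discontinuously if (i) for all $x\in{\bf R}^n$ and $\gamma\in G$, $\gamma(x)=x$ implies $\gamma=Id_{{\bf R}^n}$; and (ii) every $x\in{\bf R}^n$ has an open neighbourhood $U$ such that for $\gamma\in G$, $\gamma(U)\cap U\neq\emptyset$ implies $\gamma=Id_{{\bf R}^n}$. An ${\bf R}^n$-aspherical manifold is a topological manifold $M$ given as the quotient of ${\bf R}^n$ by a group $G$ acting continuously, freely and properly discontinuously on ${\bf R}^n$; $G$ is identified with $\pi_1(M)$ (a group of homeomorphisms of ${\bf R}^n$, not necessarily affine). An affine subspace $V$ of ${\bf R}^n$ is stable by $G$ if $g(x)\in V$ for every $x\in V$ and $g\in G$. The action of $G$ on ${\bf R}^n$ is irreducible if the only affine subspaces of ${\bf R}^n$ stable by $G$ are the empty set and ${\bf R}^n$. *)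

(* Defs.v *)
From HB Require Import structures.
From mathcomp Require Import all_boot all_order all_algebra generic_quotient.
From mathcomp Require Import all_classical all_reals all_analysis.

Set Implicit Arguments.
Unset Strict Implicit.
Unset Printing Implicit Defensive.

Import Order.TTheory GRing.Theory Num.Theory.
Import numFieldNormedType.Exports.

Local Open Scope classical_set_scope.
Local Open Scope ring_scope.

(* R^n is the space of row vectors 'rV[R]_n over R : realType, with the product
   topology.  Every member of G is continuous with an inverse in G,
   hence is a homeomorphism. *)
Record homeo_group (R : realType) (n : nat) := HomeoGroup {
  hg_mem :> ('rV[R]_n -> 'rV[R]_n) -> Prop;
  hg_continuous : forall g, hg_mem g -> continuous g;
  hg_id : hg_mem id;
  hg_comp : forall g h, hg_mem g -> hg_mem h -> hg_mem (g \o h);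
  hg_inv : forall g, hg_mem g -> exists2 h, hg_mem h & cancel g h /\ cancel h g
}.

Section Action.
Variables (R : realType) (n : nat) (G : homeo_group R n).

Definition acts_freely :=
  forall (x : 'rV[R]_n) g, G g -> g x = x -> g = id.

Definition acts_properly_discontinuously :=
  forall x : 'rV[R]_n, exists U : set 'rV[R]_n,
    [/\ open U, U x & forall g, G g -> g @` U `&` U !=set0 -> g = id].

Definition orbit_rel : rel 'rV[R]_n := fun x y => `[< exists2 g, G g & g x = y >].

Lemma orbit_rel_refl : reflexive orbit_rel.
Proof. by move=> x; apply/asboolP; exists id => //; exact: hg_id. Qed.

Lemma orbit_rel_sym : symmetric orbit_rel.
Proof.
suff sub x y : orbit_rel x y -> orbit_rel y x.
  by move=> x y; apply/idP/idP; exact: sub.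
move=> /asboolP[g Gg <-]; have [h Gh [gK _]] := hg_inv Gg.
by apply/asboolP; exists h.
Qed.

Lemma orbit_rel_trans : transitive orbit_rel.
Proof.
move=> y x z /asboolP[g Gg <-] /asboolP[h Gh <-].
by apply/asboolP; exists (h \o g) => //; exact: hg_comp.
Qed.

Definition orbit_equiv : equiv_rel 'rV[R]_n :=
  EquivRel orbit_rel orbit_rel_refl orbit_rel_sym orbit_rel_trans.

Definition orbit_space : topologicalType :=
  quotient_topology {eq_quot orbit_equiv}%qT.

End Action.

Definition locally_euclidean (R : realType) (n : nat) (M : topologicalType) :=
  forall p : M, exists U : set M, [/\ open U, U p &
    exists (f : M -> 'rV[R]_n) (g : 'rV[R]_n -> M),
      [/\ open (f @` U), {within U, continuous f},
          {within f @` U, continuous g} & forall x, U x -> g (f x) = x]].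

Definition topological_manifold (R : realType) (n : nat) (M : topologicalType) :=
  [/\ hausdorff_space M, @second_countable M & locally_euclidean R n M].

(* The manifold is M = orbit_space G, and pi_1(M) is identified with G.
   The Hausdorff condition contained in topological_manifold does not follow
   from the first two conditions. *)
Definition aspherical_manifold (R : realType) (n : nat) (G : homeo_group R n) :=
  [/\ acts_freely G, acts_properly_discontinuously G &
      topological_manifold R n (orbit_space G)].

Definition affine_subspace (R : realType) (n : nat) (V : set 'rV[R]_n) :=
  V = set0 \/ exists (a : 'rV[R]_n) (W : {vspace 'rV[R]_n}),
                V = [set a + w | w in [set` W]].

Definition stable_by (R : realType) (n : nat) (G : homeo_group R n)
    (V : set 'rV[R]_n) :=
  forall x g, V x -> G g -> V (g x).

Definition irreducible_action (R : realType) (n : nat) (G : homeo_group R n) :=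
  forall V : set 'rV[R]_n, affine_subspace V -> stable_by G V ->
    V = set0 \/ V = setT.

(* Main.v *)
From HB Require Import structures.
Require Import Defs.
From mathcomp Require Import all_boot all_order all_algebra generic_quotient.
From mathcomp Require Import finmap.
From mathcomp Require Import all_classical all_reals all_analysis.
From mathcomp Require Import ring lra.

(* Suppose that a nonempty proper affine subspace V is stable.  Since R^n and V
   are absolute extensors and R^n is covered by the translates of finitely many
   small compact sets, equivariant maps can be extended one compact set at a
   time by Tietze's theorem.  This gives an equivariant homotopy H from the
   identity of R^n to a map with values in V.  By cocompactness and proper
   discontinuity H is proper, so for p outside V the map
   x |-> H (x, c - |x|) with c large is the identity outside a ball and misses
   p.  This contradicts Brouwer's theorem, proved here through a cubical Sperner
   lemma: the mod 2 cup product of the coboundaries of n labellings of a grid is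
   a coboundary, so its sum over all cubes only depends on the boundary. *)

Set Implicit Arguments.
Unset Strict Implicit.
Unset Printing Implicit Defensive.
Import Order.TTheory GRing.Theory Num.Theory.
Import numFieldNormedType.Exports.
Local Open Scope ring_scope.

(** * A cubical Sperner lemma *)

Section CubicalSperner.
Variables (I : finType) (p : nat).
Local Notation pt := {ffun I -> nat}.

Implicit Types (s t : seq I) (S : {set I}) (i j k : I).
Implicit Types (q r : pt) (f g : pt -> 'F_2).

Definition upd (q : pt) (i : I) (a : nat) : pt :=
  [ffun j => if j == i then a else q j].

Definition succ_at (i : I) (q : pt) : pt := upd q i (q i).+1.

Lemma succ_atC i j q : succ_at i (succ_at j q) = succ_at j (succ_at i q).
Proof.
apply/ffunP => k; rewrite !ffunE.
have [->//|ij] := eqVneq i j; have [->|//] := eqVneq k i.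
by rewrite (negPf ij).
Qed.

Definition fdiff (i : I) (f : pt -> 'F_2) (q : pt) : 'F_2 :=
  f (succ_at i q) - f q.

(** The coordinates in [t] run over [0, p) and all others stay frozen at [q], so a sum over a face
    of the grid is the same function with a shorter list. *)
Fixpoint box_sum (t : seq I) (f : pt -> 'F_2) (q : pt) : 'F_2 :=
  if t is i :: t' then \sum_(0 <= a < p) box_sum t' f (upd q i a) else f q.

Lemma box_sum_ext t f g q :
    (forall r : pt, (forall k, k \notin t -> r k = q k) -> f r = g r) ->
  box_sum t f q = box_sum t g q.
Proof.
elim: t q => [|i t IH] q fg /=; first exact: fg.
apply: eq_bigr => a _; apply: IH => r rq; apply: fg => k.
by rewrite inE negb_or => /andP[/negPf ki kt]; rewrite rq// ffunE ki.
Qed.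

Lemma box_sum0 t q : box_sum t (fun=> 0) q = 0.
Proof. by elim: t q => //= i t IH q; rewrite big1. Qed.

Lemma box_sum_sum t (S : {set I}) (f : I -> pt -> 'F_2) q :
  box_sum t (fun r => \sum_(i in S) f i r) q = \sum_(i in S) box_sum t (f i) q.
Proof.
elim: t q => //= i t IH q; rewrite exchange_big /=.
by apply: eq_bigr => a _; rewrite IH.
Qed.

Lemma box_sum_diff_out t i f q : i \notin t ->
  box_sum t (fdiff i f) q = box_sum t f (succ_at i q) - box_sum t f q.
Proof.
elim: t q => //= j t IH q; rewrite inE negb_or => /andP[ij it].
rewrite -sumrB; apply: eq_bigr => a _; rewrite IH//; congr (box_sum _ _ _ - _).
apply/ffunP => k; rewrite !ffunE (negPf ij).
by have [->|//] := eqVneq k i; rewrite (negPf ij).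
Qed.

(** Discrete Stokes formula: the sum telescopes in direction [i] and leaves two opposite faces. *)
Lemma box_sum_diff_head t i f q : i \notin t ->
  box_sum (i :: t) (fdiff i f) q =
  box_sum t f (upd q i p) - box_sum t f (upd q i 0).
Proof.
move=> it /=; rewrite -(telescope_sumr (fun a => box_sum t f (upd q i a))
  (leq0n p)).
apply: eq_bigr => a _; rewrite box_sum_diff_out//; congr (box_sum _ _ _ - _).
by apply/ffunP => k; rewrite !ffunE eqxx; case: eqVneq.
Qed.

Lemma box_sum_diff0 t i f q : i \in t -> uniq t ->
  (forall r : pt, r i = 0%N \/ r i = p -> f r = 0) ->
    box_sum t (fdiff i f) q = 0.
Proof.
move=> + + f0; elim: t q => //= j t IH q; rewrite inE => + /andP[jt ut].
have [ij|ij /= it] := eqVneq i j; last by rewrite big1// => a _; exact: IH.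
rewrite -{j}ij in jt *.
rewrite -/(box_sum (i :: t) (fdiff i f) q) box_sum_diff_head//.
by rewrite !(@box_sum_ext t f (fun=> 0)) ?box_sum0 ?subrr// => r rq;
  apply: f0; rewrite rq// ffunE eqxx; [left|right].
Qed.

Lemma box_sum_neq0 t f q : box_sum t f q != 0 ->
  exists2 r, f r != 0 & forall k, k \in t -> (r k < p)%N.
Proof.
(* The induction must also record that coordinates outside [t] are unchanged: this is what bounds
   the coordinate fixed at the head of the list. *)
suff H : box_sum t f q != 0 -> exists r, [/\ f r != 0,
    forall k, k \in t -> (r k < p)%N & forall k, k \notin t -> r k = q k].
  by case/H => r [? ? _]; exists r.
elim: t q => [|i t IH] q /=; first by exists q.
move=> nz; have [a ap an] : exists2 a, (a < p)%N & box_sum t f (upd q i a) != 0.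
  have [/existsP[a an]|/existsPn a0] :=
    boolP [exists a : 'I_p, box_sum t f (upd q i a) != 0]; first by exists a.
  move: nz; rewrite big_mkord big1 ?eqxx// => a _.
  by have /negPn/eqP := a0 a.
have [r [fr rt rq]] := IH _ an; exists r; split => // k; rewrite inE.
- have [kt _|kt] := boolP (k \in t); first exact: rt.
  by rewrite orbF => /eqP ki; rewrite rq// ffunE ki eqxx.
- by rewrite negb_or => /andP[/negPf ki kt]; rewrite rq// ffunE ki.
Qed.

(** * Cup products of coboundaries of labellings *)

Variable l : I -> pt -> 'F_2.

(* The value on the cube [q + [0,1]^S] of the cubical cup product of the
   coboundaries [d (l k)], [k] ranging over [s], with coefficients mod 2. *)
Fixpoint cup (S : {set I}) (s : seq I) (q : pt) : 'F_2 :=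
  if s is k :: s' then
    \sum_(i in S) fdiff i (l k) q * cup (S :\ i) s' (succ_at i q)
  else 1.

(** In characteristic 2 the terms for (i, j) and (j, i) cancel; the enumeration order of [I] selects
    one term of each pair. *)
Lemma sum_offdiag_sym (S : {set I}) (f : I -> I -> 'F_2) :
  (forall i j, f i j = f j i) -> \sum_(i in S) \sum_(j in S :\ i) f i j = 0.
Proof.
move=> fC; have addxx (x : 'F_2) : x + x = 0.
  by rewrite -mulr2n -mulr_natl (pchar_Zp _) ?mul0r.
pose lt i j := (enum_rank i < enum_rank j)%N.
have split_lt i : \sum_(j in S :\ i) f i j =
    \sum_(j in S | lt i j) f i j + \sum_(j in S | lt j i) f i j.
  rewrite (bigID (lt i)) /=; congr (_ + _); apply: eq_bigl => j;
    rewrite !inE /lt.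
  - by have [->|] := eqVneq j i; rewrite ?ltnn ?andbF.
  - have [->|ji] /= := eqVneq j i; rewrite ?ltnn ?andbF//.
    rewrite -leqNgt [in RHS]ltn_neqAle.
    by rewrite (inj_eq (inj_comp val_inj enum_rank_inj)) ji.
rewrite (eq_bigr _ (fun i _ => split_lt i)) big_split /=.
have -> : \sum_(i in S) \sum_(j in S | lt j i) f i j =
          \sum_(i in S) \sum_(j in S | lt i j) f i j.
  rewrite (exchange_big_dep (mem S)) /=; last by move=> i j _ /andP[].
  apply: eq_bigr => i Si; apply: eq_big => [j|j _]; last exact: fC.
  by rewrite Si.
exact: addxx.
Qed.

Lemma fdiffM i f g q :
  fdiff i (fun r => f r * g r) q =
    fdiff i f q * g (succ_at i q) + f q * fdiff i g q.
Proof. by rewrite /fdiff; ring. Qed.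

(** A product of coboundaries is a cocycle. In the Leibniz expansion, the terms with second
    differences of [l k] are symmetric in the two directions and cancel; the others vanish by
    induction once the sums are exchanged. *)
Lemma cup_closed S s q : \sum_(i in S) fdiff i (cup (S :\ i) s) q = 0.
Proof.
elim: s S q => [|k s IH] S q /=; first by rewrite big1// => i _; exact: subrr.
have dE i : i \in S -> fdiff i (cup (S :\ i) (k :: s)) q =
    \sum_(j in S :\ i) fdiff i (fdiff j (l k)) q *
      cup (S :\ i :\ j) s (succ_at j (succ_at i q))
  + \sum_(j in S :\ i) fdiff j (l k) q *
      fdiff i (cup (S :\ i :\ j) s) (succ_at j q).
  move=> iS; rewrite /fdiff /= -sumrB -big_split /=; apply: eq_bigr => j jS.
  by rewrite /fdiff !(succ_atC i j); ring.
rewrite (eq_bigr _ dE) big_split /= [X in X + _]sum_offdiag_sym ?add0r.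
  rewrite (exchange_big_dep (mem S)) /=; last by move=> i j _ /setD1P[].
  rewrite big1// => j jS.
  rewrite -(big_distrr (fdiff j (l k) q)) /=.
  transitivity (fdiff j (l k) q *
    \sum_(i in S :\ j) fdiff i (cup (S :\ j :\ i) s) (succ_at j q)).
    congr (_ * _); apply: eq_big => [i|i /andP[iS ij]].
      by rewrite !inE jS andbT eq_sym andbC.
    by rewrite !finset.setDDl finset.setUC.
  by rewrite IH mulr0.
move=> i j; rewrite !finset.setDDl [[set i] :|: _]finset.setUC.
rewrite /fdiff !(succ_atC i j).
by congr (_ * _); ring.
Qed.

(** Leibniz rule: since the product over [s] is closed, multiplying it by [d (l k)] gives the
    coboundary of [l k] times it. *)
Lemma cup_cons_diff S k s q :
  cup S (k :: s) q =
    \sum_(i in S) fdiff i (fun r => l k r * cup (S :\ i) s r) q.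
Proof.
rewrite (eq_bigr _ (fun i _ => fdiffM i (l k) (cup (S :\ i) s) q)) big_split /=.
by rewrite -mulr_sumr cup_closed mulr0 addr0.
Qed.

Hypothesis l_bot : forall k (q : pt), q k = 0%N -> l k q = 0.
Hypothesis l_top : forall k (q : pt), q k = p -> l k q = 1.

(** On a cube lying in one of the two faces of the grid orthogonal to [i], the labelling [l i] is
    constant, so the factor [d (l i)] is zero. *)
Lemma cup_face0 S s i q : i \in s -> i \notin S -> q i = 0%N \/ q i = p ->
  cup S s q = 0.
Proof.
elim: s S q => //= k s IH S q; rewrite inE => + iS qi.
have stepi j : j \in S -> succ_at j q i = q i.
  by move=> jS; rewrite ffunE; case: eqVneq iS => // ->; rewrite jS.
have [ik _|ik /= is_] := eqVneq i k; rewrite big1// => j jS.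
  rewrite -ik; suff -> : fdiff j (l i) q = 0 by rewrite mul0r.
  rewrite /fdiff; case: qi => qi; first by rewrite !l_bot ?stepi// subr0.
  by rewrite !l_top ?stepi// subrr.
by rewrite IH ?mulr0 ?stepi // !inE (negPf iS) andbF.
Qed.

(** By Stokes only boundary faces contribute. In a direction other than [k] they carry a vanishing
    factor by [cup_face0]; in direction [k] the bottom face gives 0 and the top face gives the same
    sum in one dimension less. *)
Lemma box_sum_cup s q : uniq s -> box_sum s (cup [set x in s] s) q = 1.
Proof.
elim: s q => [//|k s IH] q us; have /andP[ks us'] := us.
set S := [set x in k :: s].
have kS : k \in S by rewrite !inE eqxx.
have SkE : S :\ k = [set x in s].
  apply/setP => i; rewrite !inE; case: eqVneq => //= ->.
  by rewrite (negPf ks).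
rewrite (@box_sum_ext _ _ (fun r =>
    \sum_(i in S) fdiff i (fun r => l k r * cup (S :\ i) s r) r)); last first.
  by move=> r _; rewrite cup_cons_diff.
rewrite box_sum_sum (bigD1 k)//= [X in _ + X]big1 => [|i /andP[iS ik]];
  last first.
  have is_ : i \in s by move: iS; rewrite !inE (negPf ik).
  rewrite -/(box_sum (k :: s) _ q) box_sum_diff0 ?inE ?is_ ?orbT// => r ri.
  by rewrite (cup_face0 _ _ ri) ?mulr0// !inE eqxx.
rewrite addr0 -/(box_sum (k :: s) _ q) box_sum_diff_head// SkE.
rewrite (@box_sum_ext s _ (cup [set x in s] s)) ?IH//; last first.
  by move=> r rq; rewrite l_top ?mul1r// rq// ffunE eqxx.
rewrite (@box_sum_ext s _ (fun=> 0)) ?box_sum0 ?subr0//.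
by move=> r rq; rewrite l_bot ?mul0r// rq// ffunE eqxx.
Qed.

(** A nonzero product has a nonzero term, and each factor of that term is the change of one
    labelling along an edge of the cube; [v] and [w] are the ends of that edge. *)
Lemma cup_neq0 S s q k : cup S s q != 0 -> k \in s ->
  exists v w : pt, [/\ forall j, (q j <= v j <= q j + (j \in S))%N,
                  forall j, (q j <= w j <= q j + (j \in S))%N & l k v != l k w].
Proof.
elim: s S q => //= k' s IH S q nz; rewrite inE => ks.
have [i iS] : exists2 i,
  i \in S & fdiff i (l k') q * cup (S :\ i) s (succ_at i q) != 0.
  have [/existsP[i /andP[]]|/existsPn H] := boolP [exists i, (i \in S) &&
    (fdiff i (l k') q * cup (S :\ i) s (succ_at i q) != 0)]; first by exists i.
  by move: nz; rewrite big1 ?eqxx// => i iS; have := H i;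
    rewrite iS /= => /negPn/eqP.
rewrite mulf_eq0 negb_or => /andP[dn cn].
have [kk|kk] := eqVneq k k'; last first.
  rewrite (negPf kk) /= in ks; have [v [w [vq wq vw]]] := IH _ _ cn ks.
  exists v, w; split=> // j; [have := vq j|have := wq j];
    rewrite !inE ffunE; case: eqVneq => [->|] //=; rewrite ?iS addn0 addn1;
    by move=> /andP[/ltnW-> ->].
exists (succ_at i q), q; split => [j|j|]; last by rewrite kk -subr_eq0.
  rewrite ffunE; case: eqVneq => [->|_]; first by rewrite iS addn1 leqnSn leqnn.
  by rewrite leqnn leq_addr.
by rewrite leqnn leq_addr.
Qed.

End CubicalSperner.

(** A discrete Poincare-Miranda theorem: the products sum to 1 over the grid, so some cube has a
    nonzero product, and on it every labelling takes both values. *)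
Lemma cubical_sperner (I : finType) (p : nat)
    (b : I -> {ffun I -> nat} -> bool) :
    (forall k (q : {ffun I -> nat}), q k = 0%N -> ~~ b k q) ->
    (forall k (q : {ffun I -> nat}), q k = p -> b k q) ->
  exists q : {ffun I -> nat}, (forall j, (q j < p)%N) /\
    forall k, exists v w : {ffun I -> nat},
      [/\ forall j, (q j <= v j <= (q j).+1)%N,
          forall j, (q j <= w j <= (q j).+1)%N, b k v & ~~ b k w].
Proof.
move=> b0 bp; pose l k q : 'F_2 := (b k q)%:R.
have l0 k (q : {ffun I -> nat}) : q k = 0%N -> l k q = 0.
  by move=> /b0 /negPf; rewrite /l => ->.
have lp k (q : {ffun I -> nat}) : q k = p -> l k q = 1.
  by move=> /bp; rewrite /l => ->.
have H := box_sum_cup l0 lp [ffun=> 0%N] (enum_uniq I).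
have /box_sum_neq0[q qn qp] :
    box_sum p (enum I) (cup l [set x in enum I] (enum I)) [ffun=> 0%N] != 0.
  by rewrite H oner_eq0.
exists q; split=> [j|k]; first by apply: qp; rewrite mem_enum.
have [|v [w [vq wq]]] := cup_neq0 (k := k) qn; first by rewrite mem_enum.
have le1 (x : {ffun I -> nat}) :
    (forall j, (q j <= x j <= q j + (j \in [set x in enum I]))%N) ->
    forall j, (q j <= x j <= (q j).+1)%N.
  by move=> H' j; have := H' j; rewrite inE mem_enum addn1.
rewrite /l; case bv: (b k v); case bw: (b k w); rewrite ?eqxx// => _.
- by exists v, w; rewrite bv bw; split => //; exact: le1.
- by exists w, v; rewrite bv bw; split => //; exact: le1.
Qed.

Local Open Scope classical_set_scope.

(** * Brouwer's theorem *)

Lemma ler_coord_norm (R : realType) n (x : 'rV[R]_n) i : `|x ord0 i| <= `|x|.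
Proof.
by rewrite [leRHS]/Num.norm /= mx_normrE; apply/bigmax_geP; right;
  exists (ord0, i).
Qed.

Lemma ball_rVP (R : realType) n (x y : 'rV[R]_n) (e : R) : 0 < e ->
  ball x e y <-> forall i, `|x ord0 i - y ord0 i| < e.
Proof.
move=> e0; split=> [[_ H] i|H]; first exact: H.
by split=> // j i; rewrite ord1; exact: H.
Qed.

(** If [p] were missed, some coordinate of [F - p] would keep a strict sign on every small enough
    ball. Labelling a fine grid by these signs, the Sperner lemma yields a small cube on which every
    coordinate changes sign. *)
Lemma surjective_id_outside_ball (R : realType) n (F : 'rV[R]_n -> 'rV[R]_n)
    (c : R) : continuous F -> (forall x, c <= `|x| -> F x = x) ->
  forall p, exists x, F x = p.
Proof.
move=> cF Fid p; apply: contrapT => /forallNP Fp.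
(* The cube [-a, a]^n contains [p] in its interior, and [F] is the identity on its boundary because
   [a] is at least [c]. *)
pose a := `|c| + `|p| + 1.
have a0 : 0 < a by rewrite /a ltr_wpDl// addr_ge0.
have ca : c <= a by rewrite /a (le_trans (ler_norm c))// -addrA lerDl addr_ge0.
have pa i : `|p ord0 i| < a.
  by rewrite (le_lt_trans (ler_coord_norm p i))// /a addrAC ltrDr ltr_wpDl.
pose K := [set x : 'rV[R]_n | forall i, `[- a, a]%classic (x ord0 i)].
have cK : compact K.
  by apply: (@rV_compact R n (fun=> `[- a, a]%classic)) => _;
    exact: segment_compact.
have cFi i : continuous (fun x => F x ord0 i).
  by move=> x; apply: (@continuous_comp _ _ _ F (fun M => M ord0 i) x (cF x));
    exact: coord_continuous.
pose P (d : R) (x : 'rV[R]_n) := exists i,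
  (forall y, ball x d y -> p ord0 i < F y ord0 i) \/
  (forall y, ball x d y -> F y ord0 i < p ord0 i).
have Ploc x : exists i e, 0 < e /\
    ((forall y, ball x e y -> p ord0 i < F y ord0 i) \/
     (forall y, ball x e y -> F y ord0 i < p ord0 i)).
  have [i Fpi] : exists i, F x ord0 i <> p ord0 i.
    by apply/existsNP => H; apply: (Fp x); apply/rowP.
  exists i; case: (ltgtP (F x ord0 i) (p ord0 i)) => // H.
  - have := cFi i x _ (lt_nbhsl H).
    by move=> /nbhs_ballP[e /= e0 He]; exists e; split => //; right.
  - have := cFi i x _ (lt_nbhsr H).
    by move=> /nbhs_ballP[e /= e0 He]; exists e; split => //; left.
(* A Lebesgue number argument: one radius serves all points of the compact cube. Halving [e] leaves
   room to move the centre. *)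
have : \forall d \near 0^'+, K `<=` P d.
  move/compact_near_coveringP: cK; apply => x _.
  have [i [e [e0 H]]] := Ploc x.
  have e20 : 0 < e / 2 by rewrite divr_gt0.
  exists (ball x (e / 2), [set d | d < e / 2]) => /=.
    by split; [exact: nbhsx_ballx|exact: nbhs_right_lt].
  move=> [x' d] /= [xx' de]; exists i.
  have sub y : ball x' d y -> ball x e y.
    move=> x'y; rewrite [e]splitr; apply: ball_triangle xx' _.
    exact: le_ball (ltW de) _ x'y.
  by case: H => H; [left|right] => y /sub /H.
move=> dK; have [d [d0 Pd]] : exists d : R, 0 < d /\ K `<=` P d.
  have : \forall d \near (0:R)^'+, 0 < d /\ K `<=` P d.
    by near=> d; split; near: d; [exact: nbhs_right_gt|exact: dK].
  by move/filter_ex.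
(* The mesh [2 * a / N] of the grid is less than [d], so a grid cube lies in the ball of radius [d]
   about its lowest vertex. *)
pose N := (Num.truncn (2 * a / d)).+1.
have N0 : 0 < N%:R :> R by rewrite ltr0n.
have Nd : 2 * a / N%:R < d.
  by rewrite ltr_pdivrMr// [ltRHS]mulrC -ltr_pdivrMr// truncnS_gt.
pose X (q : {ffun 'I_n -> nat}) : 'rV[R]_n :=
  \row_i (- a + 2 * a / N%:R * (q i)%:R).
pose b k (q : {ffun _ -> nat}) := p ord0 k < F (X q) ord0 k.
have [|k q qk|q [qN Hq]] := @cubical_sperner 'I_n N b.
- move=> k q qk; have Xk : X q ord0 k = - a by rewrite mxE qk mulr0 addr0.
  rewrite /b Fid; last first.
    by rewrite (le_trans ca)// (le_trans _ (ler_coord_norm _ k))//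
      Xk normrN ler_norm.
  by rewrite Xk -leNgt lerNl (le_trans _ (ltW (pa k)))// -normrN ler_norm.
- have Xk : X q ord0 k = a.
    by rewrite mxE qk mulfVK ?gt_eqF//; ring.
  rewrite /b Fid; last first.
    by rewrite (le_trans ca)// (le_trans _ (ler_coord_norm _ k))// Xk ler_norm.
  by rewrite Xk (le_lt_trans _ (pa k))// ler_norm.
have step0 : 0 < 2 * a / N%:R by rewrite divr_gt0// mulr_gt0.
have KX : K (X q).
  move=> i; rewrite /= in_itv /= mxE lerDl mulr_ge0 ?(ltW step0)//=.
  have : 2 * a / N%:R * (q i)%:R <= 2 * a / N%:R * N%:R.
    by rewrite ler_pM2l// ler_nat ltnW.
  by rewrite mulfVK ?gt_eqF//; lra.
have near_q (v : {ffun 'I_n -> nat}) :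
    (forall j, (q j <= v j <= (q j).+1)%N) -> ball (X q) d (X v).
  move=> qv; apply/ball_rVP => // i; rewrite !mxE.
  rewrite [X in `|X|](_ : _ = 2 * a / N%:R * ((q i)%:R - (v i)%:R));
    last by ring.
  rewrite normrM gtr0_norm//.
  rewrite (le_lt_trans _ Nd)// ler_piMr ?(ltW step0)//.
  have /andP[q1 q2] := qv i; rewrite distrC -natrB// normr_nat.
  by rewrite (_ : 1 = 1%:R)// ler_nat leq_subLR addn1.
have [k Hk] := Pd _ KX.
have [v [w [/near_q vq /near_q wq bv bw]]] := Hq k.
case: Hk => Hk; first by move: bw; rewrite /b Hk.
by move: bv; rewrite /b ltNge ltW// Hk.
Unshelve. all: by end_near.
Qed.

(** * Equivariant extension *)

Lemma continuous_rVP (R : realType) n (T : topologicalType)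
    (f : T -> 'rV[R]_n) :
  continuous f <-> forall i, continuous (fun x => f x ord0 i).
Proof.
split=> [cf i x|cf x].
  by apply: (@continuous_comp _ _ _ f (fun M => M ord0 i) x (cf x));
    exact: coord_continuous.
apply/cvg_ballP => e e0.
have : \forall y \near x, forall i, ball (f x ord0 i) e (f y ord0 i).
  by apply: filter_forall => i; move/cvg_ballP: (cf i x); apply.
by apply: filterS => y H; apply/ball_rVP.
Qed.

(** Tietze's theorem is applied to each coordinate; compactness of [C] supplies the bound required
    by its bounded form. *)
Lemma tietze_rV (R : realType) n (X : pseudoMetricType R) (C : set X)
    (h : X -> 'rV[R]_n) : closed C -> compact C -> {within C, continuous h} ->
  exists e : X -> 'rV[R]_n, continuous e /\ forall x, C x -> e x = h x.
Proof.
move=> clC cC ch.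
have /compact_bounded hb : compact (h @` C) by exact: continuous_compact.
have [M [M0 hM]] : exists M : R, 0 < M /\ forall x, C x -> `|h x| <= M.
  have [B [_ HB]] := hb; exists (`|B| + 1); split; first by rewrite ltr_wpDl.
  move=> x Cx; apply: (HB (`|B| + 1));
    first by rewrite (le_lt_trans (ler_norm B))// ltrDl.
  by exists x.
have /choice[g gP] (i : 'I_n) : exists g : X -> R,
    continuous g /\ forall x, C x -> g x = h x ord0 i.
  have chi : {within C, continuous (fun x => h x ord0 i : R^o)}.
    by move: ch => /continuous_rVP /(_ i).
  have hiM x : C x -> `|h x ord0 i : R^o| <= M.
    by move=> /hM; apply: le_trans; exact: ler_coord_norm.
  have [g [gh cg _]] :=
    continuous_bounded_extension pseudometric_normal clC M0 chi hiM.
  by exists g; split=> // x Cx; rewrite gh// inE.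
exists (fun x => \row_i g i x); split=> [|x Cx].
  apply/continuous_rVP => i; rewrite (_ : (fun x => _) = g i).
    by have [] := gP i.
  by apply/funext => x; rewrite mxE.
by apply/rowP => i; rewrite mxE; have [_ ->] := gP i.
Qed.

Lemma continuous_pair (S T U : topologicalType) (f : S -> T) (g : S -> U) :
  continuous f -> continuous g -> continuous (fun x => (f x, g x)).
Proof. by move=> cf cg x; exact: cvg_pair (cf x) (cg x). Qed.

Lemma linear_rV_continuous (R : realType) n (L : 'End('rV[R]_n)) : continuous L.
Proof.
apply/continuous_rVP => j.
rewrite (_ : (fun y => _) = fun y : 'rV[R]_n =>
    \sum_i y ord0 i * L (delta_mx 0 i) ord0 j); last first.
  apply/funext => y; rewrite [in LHS](row_sum_delta y) linear_sum summxE.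
  by apply: eq_bigr => i _; rewrite linearZ mxE.
elim: (index_enum _) => [|i r IH].
  rewrite (_ : (fun y => _) = cst 0); first exact: cst_continuous.
  by apply/funext => y; rewrite big_nil.
rewrite (_ : (fun y => _) =
  (fun y : 'rV[R]_n => y ord0 i * L (delta_mx 0 i) ord0 j +
    \sum_(i <- r) y ord0 i * L (delta_mx 0 i) ord0 j)).
  have cM : continuous (fun y : 'rV[R]_n => y ord0 i * L (delta_mx 0 i) ord0 j).
    by move=> y; exact: cvgM (@coord_continuous R 1 n ord0 i y) (cvg_cst _).
  by move=> y; exact: cvgD (cM y) (IH y).
by apply/funext => y; rewrite big_cons.
Qed.

Section Equivariant.
Variables (R : realType) (n : nat) (G : homeo_group R n).
Local Notation E := 'rV[R]_n.
Local Notation X := ('rV[R]_n * R)%type.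

(** * The orbit projection and saturated sets *)

Definition orbit_pi : E -> orbit_space G :=
  \pi_(quotient_topology {eq_quot (orbit_equiv G)})%qT.

Lemma orbit_piP x y : orbit_pi x = orbit_pi y <-> exists2 g, G g & g x = y.
Proof.
by split=> [/eqmodP /asboolP|H]; last by apply/eqmodP/asboolP.
Qed.

Lemma orbit_pi_continuous : continuous orbit_pi.
Proof. exact: pi_continuous. Qed.

Definition sweep (K : set E) : set E :=
  [set x | exists g k, [/\ G g, K k & g k = x]].

Lemma sweepE K : sweep K = orbit_pi @^-1` (orbit_pi @` K).
Proof.
apply/seteqP; split=> [x [g [k [Gg Kk gk]]]|x [k Kk /orbit_piP[g Gg gk]]].
  by exists k => //; apply/orbit_piP; exists g.
by exists g, k.
Qed.

Lemma sweep_stable K g x : G g -> sweep K x -> sweep K (g x).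
Proof.
by move=> Gg [f [k [Gf Kk <-]]]; exists (g \o f), k; split => //;
  exact: hg_comp.
Qed.

Lemma sweep_open U : open U -> open (sweep U).
Proof.
move=> oU; rewrite (_ : sweep U = \bigcup_(g in [set g | G g]) g @^-1` U).
  by apply: bigcup_open => g Gg; apply: open_comp => // x _;
    exact: hg_continuous Gg x.
apply/seteqP; split=> [x [g [k [Gg Uk <-]]]|x [g /= Gg Ux]].
  by have [h Gh [gK _]] := hg_inv Gg; exists h => //=; rewrite gK.
by have [h Gh [gK _]] := hg_inv Gg; exists h, (g x).
Qed.

Hypothesis hT2 : hausdorff_space (orbit_space G).

(** The image of [K] is compact, hence closed because the orbit space is Hausdorff, and [sweep K] is
    its preimage. *)
Lemma sweep_closed K : compact K -> closed (sweep K).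
Proof.
move=> cK; rewrite sweepE; apply: preimage_closed.
  by move=> x _; exact: orbit_pi_continuous.
apply: compact_closed hT2 _; apply: continuous_compact => //.
by apply: continuous_subspaceT; exact: orbit_pi_continuous.
Qed.

(** * Partial equivariant maps on R^n x R, with trivial action on the time factor *)

Definition slab (K : set E) : set X := [set z | sweep K z.1 /\ 0 <= z.2 <= 1].

Definition wandering (U : set E) :=
  forall g, G g -> g @` U `&` U !=set0 -> g = id.

(* The target is encoded by a retraction: the values are fixed by [rho]. *)
Definition equivariant_map (rho : E -> E) (A : set X) (h : X -> E) :=
  [/\ closed A, forall g z, G g -> A z -> A (g z.1, z.2),
      {within A, continuous h},
      forall g z, G g -> A z -> h (g z.1, z.2) = g (h z)
    & forall z, A z -> rho (h z) = h z].

Lemma closed_strip : closed [set z : X | 0 <= z.2 <= 1].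
Proof.
rewrite (_ : mkset _ = snd @^-1` `[0, 1]%classic); last first.
  by apply/seteqP; split=> z /=; rewrite in_itv.
apply: preimage_closed => [z _|]; first exact: cvg_snd.
exact: interval_closed.
Qed.

Lemma slab_closed K : compact K -> closed (slab K).
Proof.
move=> cK; rewrite (_ : slab K =
  fst @^-1` sweep K `&` [set z | 0 <= z.2 <= 1])//.
apply: closedI closed_strip; apply: preimage_closed => [z _|];
  first exact: cvg_fst.
exact: sweep_closed.
Qed.

(** The inverse of [g'] composed with [g] sends [u] to [u'], both in [U], so it is the identity. *)
Lemma wandering_unique U g g' u u' :
    wandering U -> G g -> G g' -> U u -> U u' ->
  g u = g' u' -> g = g' /\ u = u'.
Proof.
move=> wU Gg Gg' Uu Uu' gu; have [f Gf [g'K fK]] := hg_inv Gg'.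
have fg : f \o g = id.
  apply: wU; first exact: hg_comp.
  by exists u'; split=> //; exists u => //=; rewrite gu g'K.
have gE : g = g' by apply/funext => x; rewrite -[RHS]/(g' (id x)) -fg /= fK.
by split=> //; apply: (can_inj g'K); rewrite -[in LHS]gE.
Qed.

(* On [sweep U] the extension is [g \o rho \o e \o g^-1], where [e] is a Tietze
   extension from the piece over [K]; as [U] is wandering, [g] is determined by
   the point and locally constant. *)
Lemma equivariant_extension_step rho K U A h : continuous rho ->
    (forall g y, G g -> rho (g (rho y)) = g (rho y)) ->
    compact K -> K `<=` U -> open U -> wandering U ->
    equivariant_map rho A h ->
  exists2 h', equivariant_map rho (A `|` slab K) h' &
    forall z, A z -> h' z = h z.
Proof.
move=> crho rhoG cK KU oU wU [clA iA ch eh rh].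
(* [C] is the part of the old domain inside the compact block to be added; Tietze's theorem is
   needed only there, and equivariance spreads the result. *)
pose C := A `&` (K `*` `[0, 1]%classic).
have cC : compact C.
  rewrite /C setIC; apply: compact_closedI => //; apply: compact_setX => //.
  exact: segment_compact.
have clK : closed K by apply: compact_closed => //; exact: norm_hausdorff.
have clC : closed C.
  apply: closedI => //; rewrite (_ : K `*` _ =
    ((fst : X -> E) @^-1` K) `&` ((snd : X -> R) @^-1` `[0, 1]%classic))//.
  apply: closedI.
    by apply: preimage_closed => // z _; exact: cvg_fst.
  by apply: preimage_closed => [z _|]; [exact: cvg_snd|exact: interval_closed].
have [e [ce eC]] : exists e : X -> E,
    continuous e /\ forall z, C z -> e z = h z.
  by apply: tietze_rV => //; apply: continuous_subspaceW ch => z [].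
have /choice[k kE] (z : X) : exists y, forall g u, G g -> U u -> g u = z.1 ->
    y = g (rho (e (u, z.2))).
  have [[g [u [Gg Uu gu]]]|nz] := pselect (sweep U z.1).
    exists (g (rho (e (u, z.2)))) => g' u' Gg' Uu' gu'.
    by have [] := wandering_unique wU Gg' Gg Uu' Uu;
      rewrite ?gu ?gu'// => -> ->.
  (* Off [sweep U] the condition is vacuous and 0 is a default value. *)
  by exists 0 => g u Gg Uu gu; exfalso; apply: nz; exists g, u.
have sKU z : slab K z -> exists g u, [/\ G g, U u, K u & g u = z.1].
  by move=> [[g [u [Gg Ku gu]]] _]; exists g, u; split => //; exact: KU.
(* The point is carried into [C] by the inverse of [g]; there [e] equals [h], [rho] fixes the value,
   and equivariance of [h] carries it back. *)
have kh z : A z -> slab K z -> k z = h z.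
  move=> Az sz; have [g [u [Gg Uu Ku gu]]] := sKU _ sz.
  rewrite (kE z g u)//; have [f Gf [gK fK]] := hg_inv Gg.
  have Au : A (u, z.2) by have := iA f z Gf Az; rewrite -gu gK.
  have Cu : C (u, z.2) by split=> //; split => //=; rewrite in_itv; case: sz.
  by rewrite eC// rh// -(eh g (u, z.2))//= gu -surjective_pairing.
have ck z : slab K z -> {for z, continuous k}.
  move=> /sKU [g [u [Gg Uu _ gu]]]; have [f Gf [gK fK]] := hg_inv Gg.
  pose k' (y : X) := g (rho (e (f y.1, y.2))).
  have ck' : continuous k'.
    move=> y; rewrite /k'.
    apply: (@continuous_comp _ _ _ (fun y : X => rho (e (f y.1, y.2))) g);
      last exact: hg_continuous Gg _.
    apply: (@continuous_comp _ _ _ (fun y : X => e (f y.1, y.2)) rho);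
      last exact: crho.
    apply: (@continuous_comp _ _ _ (fun y : X => (f y.1, y.2)) e);
      last exact: ce.
    apply: (@continuous_pair _ _ _ (fun y : X => f y.1) snd);
      last by move=> ?; exact: cvg_snd.
    move=> {}y; apply: (@continuous_comp _ _ _ (fun y : X => y.1) f);
      first exact: cvg_fst.
    exact: hg_continuous Gf _.
  have kk' : \forall y \near z, k' y = k y.
    have : nbhs z (fst @^-1` (f @^-1` U)).
      apply: open_nbhs_nbhs; split; last by rewrite /= -gu gK.
      apply: open_comp => [y _|]; first exact: cvg_fst.
      by apply: open_comp => // y _; exact: hg_continuous Gf _.
    by apply: filterS => y /= Uy; rewrite /k' (kE y g (f y.1)).
  have kz : k' z = k z by exact: (nbhs_singleton kk').
  suff : k @ z --> k' z by rewrite kz.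
  by apply: cvg_trans (ck' z); apply: near_eq_cvg.
pose h' z := if `[< A z >] then h z else k z.
have h'A z : A z -> h' z = h z by rewrite /h' => Az; rewrite asboolT.
have h'K z : slab K z -> h' z = k z.
  by move=> sz; rewrite /h'; case: asboolP => // Az; rewrite kh.
have slabG g z : G g -> slab K z -> slab K (g z.1, z.2).
  by move=> Gg [sz tz]; split => //; exact: sweep_stable.
exists h' => //; split.
- exact: closedU (slab_closed cK).
- by move=> g z Gg [Az|Kz]; [left; exact: iA|right; exact: slabG].
- apply: withinU_continuous => //; first exact: slab_closed.
    by apply: subspace_eq_continuous ch => z; rewrite inE => /h'A.
  apply: (@subspace_eq_continuous _ _ _ k).
    by move=> z; rewrite inE => /h'K.
  by apply: continuous_in_subspaceT => z; rewrite inE => /ck.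
- move=> g z Gg [Az|Kz]; first by rewrite !h'A ?eh//; exact: iA.
  rewrite !h'K//; last exact: slabG.
  have [g0 [u [Gg0 Uu Ku gu]]] := sKU _ Kz.
  by rewrite (kE z g0 u)// (kE _ (g \o g0) u)//= ?gu//; exact: hg_comp.
- move=> z [Az|Kz]; first by rewrite h'A ?rh.
  by rewrite h'K//; have [g [u [Gg Uu _ gu]]] := sKU _ Kz;
    rewrite (kE z g u)// rhoG.
Qed.

Lemma equivariant_extension rho (K : E -> set E) (s : seq E) A h :
    continuous rho ->
    (forall g y, G g -> rho (g (rho y)) = g (rho y)) ->
    (forall c, compact (K c)) ->
    (forall c, exists U, [/\ K c `<=` U, open U & wandering U]) ->
    equivariant_map rho A h ->
  exists A' h', [/\ equivariant_map rho A' h', A `<=` A',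
    forall z, A z -> h' z = h z & forall c, c \in s -> slab (K c) `<=` A'].
Proof.
move=> crho rhoG cK KU; elim: s A h => [|c s IH] A h hA.
  by exists A, h; split.
have [U [KcU oU wU]] := KU c.
have [h1 hA1 h1h] := equivariant_extension_step crho rhoG (cK c) KcU oU wU hA.
have [A' [h' [hA' AA' h'h1 sA']]] := IH _ _ hA1; exists A', h'; split=> //.
- by move=> z Az; apply: AA'; left.
- by move=> z Az; rewrite h'h1 ?h1h//; left.
- move=> d; rewrite inE => /orP[/eqP->|/sA'//] z Kz.
  by apply: AA'; right.
Qed.

(** * Cocompactness, equivariant deformation and properness *)

Lemma cocompact_cover : acts_properly_discontinuously G ->
    compact [set: orbit_space G] ->
  exists (K : E -> set E) (s : seq E), [/\ forall c, compact (K c),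
    forall c, exists U, [/\ K c `<=` U, open U & wandering U] &
    forall x, exists2 c, c \in s & sweep (K c) x].
Proof.
move=> hpd hc.
have /choice[r rP] (c : E) : exists r : R, 0 < r /\
    exists U, [/\ closed_ball c r `<=` U, open U & wandering U].
  have [U [oU Uc wU]] := hpd c.
  have /nbhs_closedballP[r rU] : nbhs c U by exact: open_nbhs_nbhs.
  by exists r%:num; split => //; exists U.
(* The images of the open balls form an open cover of the orbit space, reduced to a finite one; the
   closed balls, still inside wandering open sets, serve as the compact pieces. *)
pose f c := orbit_pi @` ball c (r c).
move: hc; rewrite compact_cover => /(_ _ setT f)[||s _ sf].
- move=> c _; rewrite /open /= /quotient_open -/orbit_pi /f -sweepE.
  by apply: sweep_open; exact: ball_open.
- move=> y _; exists (repr y) => //; exists (repr y);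
  first exact: ballxx (rP _).1.
  exact: reprK.
exists (fun c => closed_ball c (r c)), (enum_fset s); split.
- move=> c; apply: bounded_closed_compact; last exact: closed_ball_closed.
  have [r0 _] := rP c.
  exists (`|c| + r c); split; first exact: num_real.
  move=> B Br x; rewrite closed_ballE// /closed_ball_ /= => xc.
  rewrite (le_trans _ (ltW Br))//
    -[x](subrK c) addrC (le_trans (ler_normD _ _))//.
  by rewrite lerD2l distrC.
- by move=> c; have [_] := rP c.
- move=> x; have [c /= cs fx] := sf (orbit_pi x) I; exists c => //.
  rewrite sweepE /=; case: fx => y cy <-; exists y => //.
  exact: subset_closed_ball.
Qed.

(** For x = g k with [k] in [K], the equation becomes g (H (k, t)) = p. Near each point of K x
    [0, 1] at most one [g] can satisfy it, which bounds g k locally; compactness makes the bound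
    uniform. *)
Lemma equivariant_proper (K : set E) (H : X -> E) (p : E) :
    acts_properly_discontinuously G -> compact K -> continuous H ->
    (forall g z, G g -> H (g z.1, z.2) = g (H z)) ->
  \forall B \near +oo, forall x t, sweep K x -> 0 <= t <= 1 -> H (x, t) = p ->
    `|x| < B.
Proof.
move=> hpd cK cH eH.
have cKI : compact (K `*` `[0, 1]%classic : set X).
  by apply: compact_setX => //; exact: segment_compact.
have : \forall B \near +oo, (K `*` `[0, 1]%classic : set X) `<=`
    fun z => forall g, G g -> g (H z) = p -> `|g z.1| < B.
  move/compact_near_coveringP: cKI; apply => z _.
  have [U [oU Uz wU]] := hpd (H z).
  have nU : nbhs z (H @^-1` U).
    by apply: open_nbhs_nbhs; split => //; apply: open_comp => // y _;
      exact: cH.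
  have [[g0 [u0 [Gg0 Uu0 gu0]]]|no] := pselect (sweep U p); last first.
    exists (H @^-1` U, setT); first by split => //; exact: filterT.
    move=> [z' B] /= [Uz' _] g Gg gp; exfalso; apply: no.
    by exists g, (H z').
  (* Only [g0] can send a point of [U] to [p], so it suffices to bound [g0] near [z.1]; the margin 1
     is arbitrary. *)
  exists ((H @^-1` U) `&` [set y | `|g0 y.1| < `|g0 z.1| + 1],
          [set B | `|g0 z.1| + 1 < B]).
    split; last exact: nbhs_pinfty_gt.
    apply: filterI => //.
    have cg : continuous (fun y : X => `|g0 y.1|).
      move=> y; apply: (@continuous_comp _ _ _ (fun y : X => g0 y.1)
        (fun x => `|x|)).
        apply: (@continuous_comp _ _ _ (fun y : X => y.1) g0);
          first exact: cvg_fst.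
        exact: hg_continuous Gg0 _.
      exact: norm_continuous.
    have H1 : `|g0 z.1| < `|g0 z.1| + 1 by rewrite ltrDl.
    exact: (cg z _ (lt_nbhsl H1)).
  move=> [z' B] /= [[Uz' lz'] lB] g Gg gp.
  have [-> _] : g = g0 /\ H z' = u0.
    by apply: wandering_unique wU Gg Gg0 _ _ _ => //; rewrite gp.
  exact: lt_trans lz' lB.
apply: filterS => B HB x t [g [k [Gg Kk gk]]] t01 Hp.
have := HB (k, t) _ g Gg; rewrite -(eH g (k, t) Gg) /= gk; apply => //.
Qed.

(** The extension result is used twice: with target the fixed set of [rho], to build the end map,
    then with target R^n, to join the identity to it. The condition on [rho] says that it is a
    retraction onto a stable set. *)
Lemma equivariant_deformation (rho : E -> E) :
    acts_properly_discontinuously G -> compact [set: orbit_space G] ->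
    continuous rho -> (forall g y, G g -> rho (g (rho y)) = g (rho y)) ->
  exists H : X -> E, [/\ continuous H,
    forall g z, G g -> H (g z.1, z.2) = g (H z),
    forall x t, t <= 0 -> H (x, t) = x
    & forall x t, 1 <= t -> rho (H (x, t)) = H (x, t)].
Proof.
move=> hpd hc crho rhoG.
have [K [s [cK wK sK]]] := cocompact_cover hpd hc.
(* The extension starts from the empty domain, with 0 as default value; only the slice at time 1 of
   the result is kept. *)
have [A1 [f [[_ _ cf ef rf] _ _ sA1]]] : exists A1 f,
    [/\ equivariant_map rho A1 f, set0 `<=` A1,
      forall z, set0 z -> f z = 0 & forall c, c \in s -> slab (K c) `<=` A1].
  apply: equivariant_extension => //.
  by split=> //; [exact: closed0|exact: continuous_subspace0].
have A1E x : A1 (x, 1).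
  by have [c cs xc] := sK x; apply: (sA1 c cs); split; rewrite //= ler01 lexx.
pose f1 x := f (x, 1).
have cf1 : continuous f1.
  move=> x; move/subspace_continuousP: cf => /(_ (x, 1) (A1E x)) cf.
  have c1 : continuous (fun y : E => (y, 1 : R)).
    exact: (@continuous_pair _ _ R id _ (fun y => @cvg_id _ (nbhs y))
      (@cst_continuous _ R 1)).
  move=> S fS; apply: (@filterS _ (nbhs x) _ _ _ _ (c1 x _ (cf S fS))) => y /=.
  by apply; exact: A1E.
have ef1 g x : G g -> f1 (g x) = g (f1 x).
  by move=> Gg; exact: ef Gg (A1E x).
pose A2 : set X := [set z | z.2 <= 0] `|` [set z | 1 <= z.2].
pose h (z : X) := if z.2 <= 0 then z.1 else f1 z.1.
have hA2 : equivariant_map id A2 h.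
  have cl0 : closed [set z : X | z.2 <= 0].
    apply: (@preimage_closed _ _ (snd : X -> R) [set t | t <= 0]).
      by move=> z _; exact: cvg_snd.
    exact: closed_le.
  have cl1 : closed [set z : X | 1 <= z.2].
    apply: (@preimage_closed _ _ (snd : X -> R) [set t | 1 <= t]).
      by move=> z _; exact: cvg_snd.
    exact: closed_ge.
  split=> //.
  - exact: closedU.
  - apply: withinU_continuous => //.
      apply: (@subspace_eq_continuous _ _ _ fst) => [z|].
        by move=> /set_mem /= z0; change (z.1 = h z); rewrite /h z0.
      by apply: continuous_subspaceT => z; exact: cvg_fst.
    apply: (@subspace_eq_continuous _ _ _ (f1 \o fst)) => [z|].
      move=> /set_mem /= z1; change (f1 z.1 = h z).
      by rewrite /h leNgt (lt_le_trans ltr01 z1).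
    apply: continuous_subspaceT => z.
    by apply: continuous_comp; [exact: cvg_fst|exact: cf1].
  - by move=> g z Gg _; rewrite /h /=; case: ifP => // _; exact: ef1.
(* Taking [id] for [rho] puts no constraint on the values, and the slabs fill the strip 0 < t < 1
   left open by [A2]. *)
have [A' [H [[_ _ cH eH _] A2A' Hh sA']]] :=
  @equivariant_extension id K s A2 h (fun x => @cvg_id _ (nbhs x))
    (fun _ _ _ => erefl) cK wK hA2.
have A'T : A' = setT.
  apply/seteqP; split => // z _.
  have [z0|z0] := leP z.2 0; first by apply: A2A'; left.
  have [z1|z1] := leP 1 z.2; first by apply: A2A'; right.
  by have [c cs xc] := sK z.1; apply: (sA' c cs); split; rewrite //= !ltW.
rewrite A'T in cH eH; exists H; split.
- by rewrite continuous_subspace_setT.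
- by move=> g z Gg; exact: eH.
- by move=> x t t0; rewrite Hh ?/h /= ?t0//; left.
- move=> x t t1; rewrite Hh ?/h /= ?leNgt ?(lt_le_trans ltr01 t1)/=;
  last by right.
  exact: rf (A1E x).
Qed.

Lemma equivariant_fiber_bounded (H : X -> E) (p : E) :
    acts_properly_discontinuously G -> compact [set: orbit_space G] ->
    continuous H -> (forall g z, G g -> H (g z.1, z.2) = g (H z)) ->
  exists B, forall x t, 0 <= t <= 1 -> H (x, t) = p -> `|x| < B.
Proof.
move=> hpd hc cH eH; have [K [s [cK _ sK]]] := cocompact_cover hpd hc.
have : \forall B \near +oo, forall c, c \in s -> forall x t,
    sweep (K c) x -> 0 <= t <= 1 -> H (x, t) = p -> `|x| < B.
  have pr c := equivariant_proper p hpd (cK c) cH eH.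
  elim: (s) => [|c s' IH]; first by near=> B.
  near=> B => d; rewrite inE => /orP[/eqP->|].
    by near: B; exact: pr.
  by move: d; near: B.
move/filter_ex => [B HB]; exists B => x t t01 Hp.
by have [c cs xc] := sK x; exact: HB cs _ _ xc t01 Hp.
Unshelve. all: by end_near.
Qed.

End Equivariant.

(** * Irreducibility of the action *)

Theorem corollary2p1 (R : realType) (n : nat) (G : homeo_group R n)
    (hM : aspherical_manifold G) (hc : compact [set: orbit_space G]%classic) :
  irreducible_action G.
Proof.
case: hM => _ hpd [hT2 _ _] V aV sV.
have [V0|/set0P[v Vv]] := eqVneq V set0; [by left|right].
case: aV => [V0|[a [W VE]]]; first by rewrite V0 in Vv.
(* An affine projection onto V = a + W; stability of [V] makes it a legitimate target for
   equivariant extension. *)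
pose rho (y : 'rV[R]_n) := a + projv W (y - a).
have Vrho y : V (rho y).
  by rewrite VE; exists (projv W (y - a)) => //=; exact: memv_proj.
have rhoV y : V y -> rho y = y.
  rewrite VE => -[w /= Ww <-].
  by rewrite /rho addrAC subrr add0r projv_id.
have crho : continuous rho.
  have cp : continuous (fun y : 'rV[R]_n => projv W (y - a)); last first.
    by move=> y; exact: cvgD (cvg_cst a) (cp y).
  move=> y; apply: (@continuous_comp _ _ _ (fun y : 'rV[R]_n => y - a)
    (projv W)).
    exact: cvgB (@cvg_id _ (nbhs y)) (cvg_cst a).
  exact: linear_rV_continuous.
have rhoG g y : G g -> rho (g (rho y)) = g (rho y).
  by move=> Gg; rewrite rhoV//; exact: sV.
have [H [cH eH H0 H1]] := equivariant_deformation hT2 hpd hc crho rhoG.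
apply: contrapT => VT; have [p Vp] : exists p, ~ V p.
  by apply/existsNP => Vall; apply: VT; apply/seteqP; split.
have [B HB] := equivariant_fiber_bounded p hpd hc cH eH.
(* [H] is the identity at time 0, so [p] itself lies in the bounded fibre. *)
have pB : `|p| < B by apply: (HB p 0); rewrite ?lexx ?ler01// H0.
(* The time is at most 0 when |x| >= B + 1, where [F] is the identity, and at least 1 when |x| <= B,
   where [F] takes values in [V]. In between, |x| > B rules out the value [p]. *)
pose F x := H (x, B + 1 - `|x|).
have cF : continuous F.
  move=> x.
  apply: (@continuous_comp _ _ _ (fun x => (x, B + 1 - `|x|)) H);
    last exact: cH.
  apply: continuous_pair => y; first exact: cvg_id.
  exact: cvgB (cvg_cst (B + 1)) (@norm_continuous _ _ y).
have [x Fx|x] := @surjective_id_outside_ball _ _ F (B + 1) cF _ p.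
  by rewrite /F H0// subr_le0.
rewrite /F; have [t0|t0] := leP (B + 1 - `|x|) 0.
  by rewrite H0// => xp; move: t0; rewrite xp; move: pB; lra.
have [t1|t1] := leP 1 (B + 1 - `|x|).
  by move=> xp; apply: Vp; rewrite -xp -H1.
by move/HB; rewrite !ltW// => /(_ isT); move: t0 t1; lra.
Qed.
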